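(* Let $n\ge 1$, let $N$ be a multiplicative, unitarily invariant, self-adjoint norm on $\mathbb{M}_n$, and let $\alpha\in[0,\pi/2)$. If $X\in\mathbb{M}_n$ and the numerical range $W(X)$ is a subset of $S_\alpha$, then $$\omega_N(X)\le \sec(\alpha)\,\omega_N(\operatorname{Re}(X)).$$
   Context: $\mathbb{M}_n$ is the algebra of $n\times n$ complex matrices. A norm $N$ on $\mathbb{M}_n$ is multiplicative if $N(XY)\le N(X)N(Y)$ for all $X,Y\in\mathbb{M}_n$; unitarily invariant if $N(UXV)=N(X)$ for all $X\in\mathbb{M}_n$ and all unitary $U,V\in\mathbb{M}_n$; self-adjoint if $N(X^* )=N(X)$ for all $X$. Here $\operatorname{Re}(X)=\frac{X+X^*}{2}$, and the generalized numerical radius induced by $N$ is $\omega_N(X)=\sup_{\theta\in\mathbb{R}}N(\operatorname{Re}(e^{i\theta}X))$. The numerical range of $X$ is $W(X)=\{\langle Xx,x\rangle: x\in\mathbb{C}^n,\ \|x\|=1\}$, and $S_\alpha=\{x+iy\in\mathbb{C}: x>0,\ |y|\le \tan(\alpha)\,x\}$. *)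

(* Defs.v *)
From mathcomp Require Import all_boot all_order all_algebra spectral.
From mathcomp Require Import all_classical all_reals all_analysis.
From mathcomp Require Export complex.

Set Implicit Arguments.
Unset Strict Implicit.
Unset Printing Implicit Defensive.

Import Order.TTheory GRing.Theory Num.Theory.

Local Open Scope classical_set_scope.
Local Open Scope sesquilinear_scope.
Local Open Scope ring_scope.
Local Open Scope complex_scope.

Section Norms.
Context {R : realType} {n : nat}.
Implicit Type N : 'M[R[i]]_n -> R.

Record is_norm N : Prop := IsNorm {
  norm_ge0 : forall X, 0 <= N X;
  norm_eq0 : forall X, N X = 0 -> X = 0;
  norm_scale : forall (c : R[i]) X, N (c *: X) = Normc.normc c * N X;
  norm_triangle : forall X Y, N (X + Y) <= N X + N Y }.

Definition multiplicative_norm N : Prop :=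
  forall X Y, N (X *m Y) <= N X * N Y.

Definition unitarily_invariant N : Prop :=
  forall X U V, U \is unitarymx -> V \is unitarymx -> N (U *m X *m V) = N X.

Definition self_adjoint_norm N : Prop := forall X, N (X ^t*) = N X.

End Norms.

Section NumericalRadius.
Context {R : realType} {n : nat}.

Definition re_mx (X : 'M[R[i]]_n) : 'M[R[i]]_n := 2^-1 *: (X + X ^t*).

Definition expi (theta : R) : R[i] := cos theta +i* sin theta.

(* [sup] is real-valued and defaults to 0 on sets without a supremum; this never
   happens when [N] is a norm, see [has_sup_numerical_radius]. *)
Definition numerical_radius (N : 'M[R[i]]_n -> R) (X : 'M[R[i]]_n) : R :=
  sup (range (fun theta : R => N (re_mx (expi theta *: X)))).

Lemma normc_expi (theta : R) : Normc.normc (expi theta) = 1.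
Proof. by rewrite /= cos2Dsin2 sqrtr1. Qed.

Lemma has_sup_numerical_radius (N : 'M[R[i]]_n -> R) (X : 'M[R[i]]_n) :
  is_norm N ->
  has_sup (range (fun theta : R => N (re_mx (expi theta *: X)))).
Proof.
move=> hN; split; first by exists (N (re_mx (expi 0 *: X))), 0.
exists (Normc.normc (2^-1 : R[i]) * (N X + N (X ^t*))) => _ [t _ <-].
rewrite /re_mx (norm_scale hN); apply: ler_wpM2l; first exact: sqrtr_ge0.
apply: le_trans (norm_triangle hN _ _) _.
rewrite linearZ /= map_mxZ !(norm_scale hN) normc_expi mul1r.
suff -> : Normc.normc (expi t)^* = 1 by rewrite mul1r.
by rewrite /= sqrrN cos2Dsin2 sqrtr1.
Qed.

End NumericalRadius.

Section NumericalRange.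
Context {R : realType} {n : nat}.

Definition cinner (x y : 'cV[R[i]]_n) : R[i] := \sum_i x i 0 * (y i 0)^*.

Definition cnorm (x : 'cV[R[i]]_n) : R :=
  Num.sqrt (\sum_i Normc.normc (x i 0) ^+ 2).

Definition numerical_range (X : 'M[R[i]]_n) : set R[i] :=
  [set cinner (X *m x) x | x in [set x : 'cV[R[i]]_n | cnorm x = 1]].

End NumericalRange.

Definition sector {R : realType} (alpha : R) : set R[i] :=
  [set z | 0 < complex.Re z /\ `|complex.Im z| <= tan alpha * complex.Re z].

(* Main.v *)
(** Let [z = <Xv,v>] for a unit vector [v].  As [z] lies in the sector of
    half-angle [alpha], [|Re (e^(i theta) z)| <= sec alpha * Re z], that is,
    [- A <= H <= A] in the Loewner order, with [H = Re (e^(i theta) X)] and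
    [A = sec alpha * Re X].  In an orthonormal eigenbasis of [H] this says that
    [H = T * diag A] with [T] a real diagonal contraction.  Now [diag A] and
    [T * diag A] are obtained by repeatedly averaging a matrix with its images
    under sign changes of one row (and column), and such averages do not
    increase a unitarily invariant norm; hence [N H <= N A]. *)
Require Import Defs.
From mathcomp Require Import all_boot all_order all_algebra.
From mathcomp Require Import all_classical all_reals all_analysis.
From mathcomp Require Import spectral ring lra.

Set Implicit Arguments.
Unset Strict Implicit.
Unset Printing Implicit Defensive.

Import Order.TTheory GRing.Theory Num.Theory.

Local Open Scope classical_set_scope.
Local Open Scope ring_scope.
Local Open Scope sesquilinear_scope.
Local Open Scope complex_scope.

Lemma le_of_eq (R : realType) (x y : R) : x = y -> x <= y.
Proof. by move->. Qed.

Lemma normc_real (R : realType) (r : R) : Normc.normc r%:C = `|r|.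
Proof. by rewrite /= expr0n /= addr0 sqrtr_sqr. Qed.

Section UnitarilyInvariant.
Context {R : realType} {n : nat} (N : 'M[R[i]]_n -> R).
Hypotheses (hN : is_norm N) (hunit : unitarily_invariant N).
Implicit Types M A H P U V : 'M[R[i]]_n.

(** Both weights are nonnegative because [|t| <= 1], and they sum to 1. They are chosen so that an
    entry which [U] and [V] leave fixed keeps the factor 1, while one whose sign they flip gets the
    factor [t]. *)
Lemma norm_convex_unitary M U V (t : R) :
  U \is unitarymx -> V \is unitarymx -> `|t| <= 1 ->
  N (((1 + t) / 2)%:C *: M + ((1 - t) / 2)%:C *: (U *m M *m V)) <= N M.
Proof.
move=> hU hV; rewrite ler_norml => /andP[t1 t2].
apply: le_trans (norm_triangle hN _ _) _.
rewrite !(norm_scale hN) (hunit _ hU hV) !normc_real !ger0_norm; lra.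
Qed.

Definition flip_mx (k : 'I_n) : 'M[R[i]]_n :=
  diag_mx (\row_j (-1) ^+ (j == k)).

Lemma flip_mx_unitary k : flip_mx k \is unitarymx.
Proof.
apply/unitarymxP/matrixP => i j; rewrite mul_diag_mx !mxE.
case: (eqVneq i j) => [->|ne]; last first.
  by rewrite mulr0n conjC0 mulr0.
rewrite mulr1n rmorphXn /= rmorphN1 -expr2 -exprM mulnC exprM sqrrN.
by rewrite !expr1n.
Qed.

(** Averaging with the row flip alone ([V = 1]): row [k] gets (1 + t)/2 - (1 - t)/2 = t. *)
Lemma norm_scale_row M (k : 'I_n) (t : R) : `|t| <= 1 ->
  N (\matrix_(i, j) ((if i == k then t else 1)%:C * M i j)) <= N M.
Proof.
move=> ht; have h1 : (1%:M : 'M[R[i]]_n) \is unitarymx.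
  by apply/unitarymxP; rewrite trmx1 map_mx1 mulmx1.
apply: le_trans (norm_convex_unitary M (flip_mx_unitary k) h1 ht).
apply/le_of_eq; congr N.
apply/matrixP => i j; rewrite mulmx1 mul_diag_mx !mxE.
case: eqVneq => _; rewrite ?expr1 ?expr0 mulrA -mulrDl; congr (_ * _).
  by apply/eqP; rewrite mulrN1 eq_complex /=; apply/andP; split; apply/eqP; lra.
by apply/eqP; rewrite mulr1 eq_complex /=; apply/andP; split; apply/eqP; lra.
Qed.

Lemma norm_mul_diag_real M (t : 'I_n -> R) : (forall i, `|t i| <= 1) ->
  N (diag_mx (\row_i (t i)%:C) *m M) <= N M.
Proof.
move=> ht.
(* Rows are scaled one at a time; [uniq] ensures that row [k] still has the factor 1 when its turn
   comes. *)
suff H (s : seq 'I_n) : uniq s ->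
    N (\matrix_(i, j) ((if i \in s then t i else 1)%:C * M i j)) <= N M.
  apply: le_trans (H _ (enum_uniq 'I_n)).
  apply/le_of_eq; congr N.
  by apply/matrixP => i j; rewrite mul_diag_mx !mxE mem_enum.
elim: s => [_|k s IH /= /andP[ks us]].
  apply/le_of_eq; congr N.
  by apply/matrixP => i j; rewrite !mxE mul1r.
apply: le_trans (IH us); apply: le_trans (norm_scale_row _ k (ht k)).
apply/le_of_eq; congr N.
apply/matrixP => i j; rewrite !mxE inE.
by case: eqVneq => [->|_]; rewrite /= ?(negPf ks) mul1r.
Qed.

(** The case [t = 0], with the flip on both sides: the entries whose sign changes are those with
    exactly one index equal to [k], and the average cancels them. *)
Lemma norm_pinch_row_col M (k : 'I_n) :
  N (\matrix_(i, j) (if (i == k) == (j == k) then M i j else 0)) <= N M.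
Proof.
have h0 : `|0 : R| <= 1 by rewrite normr0.
have hk := flip_mx_unitary k.
apply: le_trans (norm_convex_unitary M hk hk h0).
apply/le_of_eq; congr N.
apply/matrixP => i j; rewrite mul_mx_diag mul_diag_mx !mxE.
have hh : ((1 + 0) / 2 : R)%:C = 2^-1.
  by apply: (mulIf (_ : 2 != 0)); rewrite ?pnatr_eq0// mulVf ?pnatr_eq0//;
     apply/eqP; rewrite eq_complex /=; apply/andP; split; apply/eqP; lra.
rewrite subr0 addr0 in hh *; rewrite hh.
by case: (i == k) (j == k) => [] []; rewrite /= ?expr1 ?expr0; field.
Qed.

Lemma norm_pinching M :
  N (\matrix_(i, j) (if i == j then M i j else 0)) <= N M.
Proof.
suff H (s : seq 'I_n) :
    N (\matrix_(i, j) (if all (fun k => (i == k) == (j == k)) s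
                       then M i j else 0)) <= N M.
  apply: le_trans (H (enum 'I_n)).
  apply/le_of_eq; congr N.
  apply/matrixP => i j; rewrite !mxE; congr (if _ then _ else _).
  (* The test at [k = i] alone already forces [j = i]. *)
  apply/idP/allP => [/eqP-> k _ //|/(_ i)].
  by rewrite mem_enum eqxx => /(_ isT) /eqP e; rewrite eq_sym -e.
elim: s => [|k s IH].
  apply/le_of_eq; congr N.
  by apply/matrixP => i j; rewrite !mxE.
apply: le_trans IH; apply: le_trans (norm_pinch_row_col _ k).
apply/le_of_eq; congr N.
apply/matrixP => i j; rewrite !mxE /=. by case: (_ == (j == k)).
Qed.

(** For [P = spectralmx H] these vectors are eigenvectors of [H], so a bound on quadratic forms
    becomes a bound on diagonal entries. *)
Lemma cinner_unitary_row M P i :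
  (P *m M *m P^t*) i i = cinner (M *m (row i P)^t*) ((row i P)^t*).
Proof.
rewrite -mulmxA mxE /cinner; apply: eq_bigr => k _.
rewrite mulrC !mxE conjCK; congr (_ * _).
by apply: eq_bigr => l _; rewrite !mxE.
Qed.

Lemma cnorm_unitary_row P i : P \is unitarymx -> cnorm ((row i P)^t*) = 1.
Proof.
move=> /unitarymxP /matrixP /(_ i i); rewrite !mxE eqxx => h.
apply/eqP; rewrite -sqrtr1 /cnorm; apply/eqP; congr Num.sqrt.
(* In [R[i]] the squared modulus becomes a product with the conjugate, as in the diagonal entry [h]
   of the unitarity equation. *)
apply: (@complexI R); rewrite rmorph_sum -[RHS]h; apply: eq_bigr => k _.
by rewrite !mxE rmorphXn /= -[X in X ^+ 2]/(`|(P i k)^*|) norm_conjC normCK.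
Qed.

Lemma norm_le_quadratic_form A H : H \is normalmx ->
  (forall v, cnorm v = 1 ->
    - cinner (A *m v) v <= cinner (H *m v) v <= cinner (A *m v) v) ->
  N H <= N A.
Proof.
move=> hH hle; pose P := spectralmx H.
have hP : P \is unitarymx by exact: spectral_unitarymx.
have hP' : P^t* \is unitarymx by rewrite trmxC_unitary.
have HE : P *m H *m P^t* = diag_mx (spectral_diag H).
  rewrite -(invmx_unitary hP) [X in _ *m X *m _](orthomx_spectralP hH) !mulmxA.
  by rewrite mulmxV ?unitarymx_unit // mul1mx mulmxK ?unitarymx_unit.
rewrite -(hunit H hP hP') -(hunit A hP hP').
set B := P *m A *m P^t*; set D := P *m H *m P^t* in HE *.
have hBD i : - B i i <= D i i <= B i i.
  by rewrite !cinner_unitary_row; apply/hle/cnorm_unitary_row.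
(* If [B i i = 0] then [D i i = 0] as well, and the junk value [t i = 0] works. *)
pose t i := complex.Re (D i i) / complex.Re (B i i).
have hB i : [/\ B i i = (complex.Re (B i i))%:C, D i i = (complex.Re (D i i))%:C
    & `|complex.Re (D i i)| <= complex.Re (B i i)].
  have := hBD i; case: (B i i) (D i i) => a a' [d d'].
  rewrite !lecE /= => /andP[/andP[/eqP e1 h1] /andP[/eqP e2 h2]].
  (* The order on [R[i]] compares only numbers with equal imaginary parts, so [- a' = d' = a']: both
     diagonal entries are real. *)
  have e3 : a' = 0 by lra.
  by split; rewrite ?ler_norml ?h1 ?h2 // -?e2 e3.
apply: le_trans (norm_pinching B).
have ht i : `|t i| <= 1.
  have [_ _ h] := hB i; rewrite normrM normfV.
  have [->|h0] := eqVneq (complex.Re (B i i)) 0; first by rewrite normr0 invr0 mulr0.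
  have hp : 0 < complex.Re (B i i).
    by rewrite lt_neqAle eq_sym h0 (le_trans _ h).
  by rewrite (gtr0_norm hp) ler_pdivrMr // mul1r.
apply: le_trans (norm_mul_diag_real _ ht).
apply/le_of_eq; congr N.
(* It remains to see that [D] is [diag t] times the pinched [B]; off the diagonal both vanish, [D]
   by [HE]. *)
apply/matrixP => i j; rewrite mul_diag_mx [RHS]mxE [X in X * _]mxE [X in _ * X]mxE.
have [<-|ne] := eqVneq i j; last by rewrite HE mxE (negPf ne) mulr0.
have [{2}-> -> h] := hB i; rewrite -rmorphM /=; congr _%:C; rewrite /t.
have [e|h0] := eqVneq (complex.Re (B i i)) 0; last by rewrite divfK.
by move: h; rewrite e mulr0 normr_le0 => /eqP.
Qed.

End UnitarilyInvariant.

Section RealPart.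
Context {R : realType} {n : nat}.
Implicit Types (X : 'M[R[i]]_n) (v : 'cV[R[i]]_n).

Lemma cinnerZl (c : R[i]) (x y : 'cV[R[i]]_n) : cinner (c *: x) y = c * cinner x y.
Proof. by rewrite mulr_sumr; apply: eq_bigr => i _; rewrite mxE mulrA. Qed.

Lemma cinner_adjoint X v : cinner (X^t* *m v) v = (cinner (X *m v) v)^*%R.
Proof.
rewrite /cinner rmorph_sum /=.
under eq_bigr do rewrite mxE mulr_suml.
under [RHS]eq_bigr do rewrite mxE rmorphM rmorph_sum /= mulr_suml.
rewrite exchange_big; apply: eq_bigr => i _; apply: eq_bigr => j _.
by rewrite !mxE rmorphM conjCK; ring.
Qed.

Lemma cinner_re_mx X v :
  cinner (re_mx X *m v) v = (complex.Re (cinner (X *m v) v))%:C.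
Proof.
have conjE : (cinner (X *m v) v)^*%C = cinner (X^t* *m v) v.
  exact/esym/cinner_adjoint.
rewrite ReJ_add conjE /re_mx -scalemxAl cinnerZl mulmxDl mulrC; congr (_ / _).
rewrite -big_split; apply: eq_bigr => i _.
by rewrite mxE mulrDl.
Qed.

Lemma re_mx_hermitian X : (re_mx X)^t* = re_mx X.
Proof.
rewrite /re_mx linearZ /= map_mxZ linearD /= map_mxD trmxCK addrC.
by rewrite fmorphV rmorph_nat.
Qed.

Lemma re_mx_idem X : re_mx (re_mx X) = re_mx X.
Proof.
rewrite {1}/re_mx re_mx_hermitian -mulr2n -[re_mx X *+ 2]scaler_nat.
by rewrite scalerA mulVf ?scale1r.
Qed.

Lemma re_mx_normal X : re_mx X \is normalmx.
Proof. by apply/normalmxP; rewrite re_mx_hermitian. Qed.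

End RealPart.

Lemma cos_gt0_acute (R : realType) (alpha : R) :
  0 <= alpha < pi / 2 -> 0 < cos alpha.
Proof.
move=> /andP[a0 a1]; apply: cos_gt0_pihalf; rewrite a1 andbT.
by apply: lt_le_trans a0; have := @pi_gt0 R; lra.
Qed.

(** For z = x + iy, the real part is x cos theta - y sin theta. Multiplying by cos alpha and using
    cos alpha |y| <= sin alpha x leaves |cos theta| cos alpha + |sin theta| sin alpha <= 1. *)
Lemma Re_rotate_sector (R : realType) (alpha theta : R) (z : R[i]) :
  0 <= alpha < pi / 2 -> sector alpha z ->
  `|complex.Re (expi theta * z)| <= (cos alpha)^-1 * complex.Re z.
Proof.
move=> ha; have c0 := cos_gt0_acute ha; case: z => x y [/= x0 hy].
rewrite -(ler_pM2l c0) mulrA mulfV ?gt_eqF // mul1r -[X in X * _](gtr0_norm c0).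
rewrite -normrM.
have {}hy : `|cos alpha * y| <= sin alpha * x.
  by rewrite normrM (gtr0_norm c0) mulrC -ler_pdivlMr // mulrAC; exact: hy.
have s0 : 0 <= sin alpha.
  by case/andP: ha => a0 a1; apply: sin_ge0_pi; rewrite a0 /=; lra.
apply: (@le_trans _ _ (`|cos theta| * cos alpha * x + `|sin theta| * sin alpha * x)).
  rewrite mulrBr; apply: le_trans (ler_normB _ _) _; apply: lerD.
    by rewrite !normrM (gtr0_norm c0) (gtr0_norm x0); apply/le_of_eq; ring.
  by rewrite mulrCA normrM -mulrA ler_wpM2l.
rewrite -mulrDl ger_pMl //.
have hc := cos2Dsin2 theta; have hs := cos2Dsin2 alpha.
rewrite -(real_normK (num_real (cos theta))) -(real_normK (num_real (sin theta))) in hc.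
(* The two squares add up to 2 minus twice the left-hand side. *)
by have := sqr_ge0 (`|cos theta| - cos alpha);
  have := sqr_ge0 (`|sin theta| - sin alpha); nra.
Qed.

Theorem proposition2p3 (R : realType) (n : nat) (hn : (1 <= n)%N)
    (N : 'M[R[i]]_n -> R) (hN : is_norm N) (hmul : multiplicative_norm N)
    (hunit : unitarily_invariant N) (hself : self_adjoint_norm N)
    (alpha : R) (halpha0 : 0 <= alpha) (halpha1 : alpha < pi / 2)
    (X : 'M[R[i]]_n) (hW : numerical_range X `<=` sector alpha) :
  numerical_radius N X <= (cos alpha)^-1 * numerical_radius N (re_mx X).
Proof.
have halpha : 0 <= alpha < pi / 2 by rewrite halpha0.
have c0 : 0 < (cos alpha)^-1 by rewrite invr_gt0 cos_gt0_acute.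
have le_radius : N (re_mx X) <= numerical_radius N (re_mx X).
  apply: (sup_upper_bound (has_sup_numerical_radius (re_mx X) hN)).
  (* The angle 0 suffices, since [re_mx X] is its own real part. *)
  by exists 0 => //; rewrite /expi cos0 sin0 scale1r re_mx_idem.
apply: le_trans (ler_wpM2l (ltW c0) le_radius).
apply: ge_sup; first by exists (N (re_mx (expi 0 *: X))), 0.
move=> _ [theta _ <-].
(* The secant moves inside [N], so that the dominating matrix is sec alpha times [re_mx X]. *)
rewrite -[X in X * _](gtr0_norm c0) -normc_real -(norm_scale hN).
apply: (norm_le_quadratic_form hN hunit (re_mx_normal _)) => v hv.
rewrite -scalemxAl cinnerZl !cinner_re_mx -scalemxAl cinnerZl.
have := Re_rotate_sector theta halpha (hW _ (ex_intro2 _ _ v hv erefl)).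
by rewrite ler_norml -rmorphM -rmorphN /= !lecR.
Qed.
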